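(* The multiplication maps $$(\pi^{3\text{-}dim}_r,\mathcal{V}'^+_{3\text{-}dim})\times(\rho'_2,\mathring{\mathcal{W}}'_{1/2})\times(\pi^{3\text{-}dim}_l,\mathcal{V}^+_{3\text{-}dim})\to(\rho_M,M),$$ $$(\pi^{3\text{-}dim}_r,\mathcal{V}'^-_{3\text{-}dim})\times(\rho'_2,\mathring{\mathcal{W}}'_{1/2})\times(\pi^{3\text{-}dim}_l,\mathcal{V}^-_{3\text{-}dim})\to(\rho_M,M),$$ both given by $(g,F,f)\mapsto gFf$, are $\mathfrak{sp}(4,\mathbb{C})$-equivariant; that is, for all $X\in\mathfrak{sp}(4,\mathbb{C})$, $\rho_M(X)(gFf)=(\pi^{3\text{-}dim}_r(X)g)Ff+g(\rho'_2(X)F)f+gF(\pi^{3\text{-}dim}_l(X)f)$.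
   Context: Let $Z=\begin{pmatrix} z_{11} & z_{12} \\ z_{12} & z_{22} \end{pmatrix}$ denote a complex symmetric $2\times2$ matrix, $z_{12}=it$; use coordinates $z_{11},z_{22},t$; $N(Z)=\det Z=z_{11}z_{22}+t^2$. Let $P=\mathbb{C}[z_{11},z_{12},z_{22},N(Z)^{-1}]$ and let $N(Z)^{1/2}P$ be the corresponding space with half-integer powers of $N(Z)$ (adjoin a formal square root of $N(Z)$ to $P$; derivations extend uniquely). Let $\mathrm{Sym}$ be the space of complex symmetric $2\times2$ matrices, $\mathbb{S}=\mathbb{C}^2$ (columns), $\mathbb{S}'=\mathbb{C}^2$ (rows). Put $\partial=\begin{pmatrix} \partial_{z_{11}} & -\frac i2\partial_t \\ -\frac i2\partial_t & \partial_{z_{22}} \end{pmatrix}$, $\partial^+=\begin{pmatrix} \partial_{z_{22}} & \frac i2\partial_t \\ \frac i2\partial_t & \partial_{z_{11}} \end{pmatrix}$. $\mathfrak{sp}(4,\mathbb{C})=\{\begin{pmatrix} A & B \\ C & -A^T \end{pmatrix}:B^T=B,\,C^T=C\}$ ($2\times2$ blocks). Below $A$, $B$, $C$ stand for $\begin{pmatrix} A & 0 \\ 0 & -A^T \end{pmatrix}$, $\begin{pmatrix} 0 & B \\ 0 & 0 \end{pmatrix}$, $\begin{pmatrix} 0 & 0 \\ C & 0 \end{pmatrix}$. In all the modules $B$ acts by $-\mathrm{Tr}(B\partial)$. $M=N(Z)^{1/2}P$ with $\rho_M(A)f=-\mathrm{Tr}(AZ\partial+ZA^T\partial+3A)f$,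 $\rho_M(C)f=\mathrm{Tr}(ZCZ\partial+3CZ)f$. $\mathring{\mathcal{W}}'_{1/2}=\mathrm{Sym}\otimes N(Z)^{1/2}P$ with $\rho'_2(A)F=-\mathrm{Tr}(AZ\partial+ZA^T\partial+2A)F+AF+FA^T$, $\rho'_2(C)F=\mathrm{Tr}(ZCZ\partial+2ZC)F-ZCF-FCZ$. $\mathcal{V}^+_{3\text{-}dim}=\{f\in\mathbb{S}\otimes P:\partial^+f=0\}$, $\mathcal{V}^-_{3\text{-}dim}=\{f\in\mathbb{S}\otimes N(Z)^{1/2}P:\partial^+f=0\}$, with $\pi^{3\text{-}dim}_l(A)f=-\mathrm{Tr}(AZ\partial+ZA^T\partial+\tfrac12A)f-A^Tf$, $\pi^{3\text{-}dim}_l(C)f=\mathrm{Tr}(ZCZ\partial+\tfrac12CZ)f+CZf$. $\mathcal{V}'^+_{3\text{-}dim}=\{g\in\mathbb{S}'\otimes P:g\overleftarrow{\partial^+}=0\}$, $\mathcal{V}'^-_{3\text{-}dim}=\{g\in\mathbb{S}'\otimes N(Z)^{1/2}P:g\overleftarrow{\partial^+}=0\}$ (operator applied by right matrix multiplication), with $\pi^{3\text{-}dim}_r(A)g=-\mathrm{Tr}(AZ\partial+ZA^T\partial+\tfrac12A)g-gA$, $\pi^{3\text{-}dim}_r(C)g=\mathrm{Tr}(ZCZ\partial+\tfrac12ZC)g+gZC$. *)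

(* Defs.v *)
From HB Require Import structures.
From mathcomp Require Import all_boot all_order all_algebra.
From mathcomp Require Import reals complex.
From mathcomp Require Import mpoly.
From mathcomp Require Import ring.

Set Implicit Arguments.
Unset Strict Implicit.
Unset Printing Implicit Defensive.

Import GRing.Theory Pdiv.Ring Pdiv.RingMonic.
Local Open Scope ring_scope.
Local Open Scope quotient_scope.

Definition mx2 (T : Type) (a b c d : T) : 'M[T]_2 :=
  \matrix_(i, j) if i == 0 then (if j == 0 then a else b)
                 else (if j == 0 then c else d).

(* The quotient rule, on the numerator and denominator of a representative; when
   D is a derivation the result does not depend on the representative. *)
Definition frac_der (A : idomainType) (D : A -> A) (x : {fraction A}) :
  {fraction A} :=
  let n := \n_(repr x) in let d := \d_(repr x) in
  FracField.tofrac (D n * d - n * D d) / FracField.tofrac d ^+ 2.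

Section FracDer.
Variables (A : idomainType) (D : A -> A).
Hypothesis DD : {morph D : x y / x + y}.
Hypothesis DM : forall x y, D (x * y) = D x * y + x * D y.
Local Notation tof := (@FracField.tofrac A).
Local Notation dfrac := (frac_der D).

Let numden (x : {fraction A}) : exists p q : A,
  [/\ q != 0, p = \n_(repr x), q = \d_(repr x) & x = tof p / tof q].
Proof.
exists \n_(repr x), \d_(repr x); split => //; first exact: denom_ratioP.
have dn : tof \d_(repr x) != 0.
  rewrite tofrac_eq0; exact: denom_ratioP.
apply: (canRL (mulfK dn)).
rewrite -[x in LHS]reprK; unlock FracField.tofrac.
rewrite -[LHS]FracField.pi_mul; apply/eqmodP => /=.
rewrite FracField.equivfE /FracField.mulf !numden_Ratio ?oner_eq0 ?mulr1 //.
by rewrite reprK mulrC.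
all: exact: denom_ratioP.
Qed.

Let quot_uniq (K : fieldType) (p q d p' q' d' n n' : K) :
  d != 0 -> q != 0 ->
  p * d = n * q -> p' * d + p * d' = n' * q + n * q' ->
  (n' * d - n * d') / d ^+ 2 = (p' * q - p * q') / q ^+ 2.
Proof.
move=> d0 q0 e1 e2.
have en : n = p * d / q by rewrite e1 mulfK.
have e3 : n' = (p' * d + p * d' - n * q') / q by rewrite e2 addrK mulfK.
by rewrite e3 en; field; apply/andP.
Qed.

Let quot_add (K : fieldType) (p q d p' q' d' n n' : K) : d != 0 -> q != 0 ->
  ((p' * d + p * d' + (n' * q + n * q')) * (q * d)
   - (p * d + n * q) * (q' * d + q * d')) / (q * d) ^+ 2 =
  (p' * q - p * q') / q ^+ 2 + (n' * d - n * d') / d ^+ 2.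
Proof. by move=> d0 q0; field; apply/andP. Qed.

Let quot_mul (K : fieldType) (p q d p' q' d' n n' : K) : d != 0 -> q != 0 ->
  ((p' * n + p * n') * (q * d) - (p * n) * (q' * d + q * d')) / (q * d) ^+ 2 =
  (p' * q - p * q') / q ^+ 2 * (n / d)
  + p / q * ((n' * d - n * d') / d ^+ 2).
Proof. by move=> d0 q0; field; apply/andP. Qed.

Lemma frac_derE (p q : A) : q != 0 ->
  dfrac (tof p / tof q) = tof (D p * q - p * D q) / tof q ^+ 2.
Proof.
move=> q0; rewrite /frac_der.
have [n [d [d0 <- <- e]]] := numden (tof p / tof q).
have d0' : tof d != 0 by rewrite tofrac_eq0.
have q0' : tof q != 0 by rewrite tofrac_eq0.
have e1 : p * d = n * q.
  by apply/eqP; rewrite -tofrac_eq !tofracM -eqr_div // e.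
have e2 := congr1 D e1.
rewrite !DM in e2.
rewrite !(tofracB, tofracM); apply: quot_uniq => //.
  by rewrite -!tofracM e1.
by rewrite -!tofracM -!tofracD e2.
Qed.

Lemma frac_derD : {morph dfrac : x y / x + y}.
Proof.
move=> x y.
have [p [q [q0 _ _ ->]]] := numden x.
have [n [d [d0 _ _ ->]]] := numden y.
have q0' : tof q != 0 by rewrite tofrac_eq0.
have d0' : tof d != 0 by rewrite tofrac_eq0.
rewrite addf_div // -!tofracM -tofracD !frac_derE ?mulf_neq0 //.
by rewrite !(DD, DM) !(tofracB, tofracD, tofracM); apply: quot_add.
Qed.

Lemma frac_derM x y : dfrac (x * y) = dfrac x * y + x * dfrac y.
Proof.
have [p [q [q0 _ _ ->]]] := numden x.
have [n [d [d0 _ _ ->]]] := numden y.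
have q0' : tof q != 0 by rewrite tofrac_eq0.
have d0' : tof d != 0 by rewrite tofrac_eq0.
rewrite mulf_div // -!tofracM !frac_derE ?mulf_neq0 //.
by rewrite !(DD, DM) !(tofracB, tofracD, tofracM); apply: quot_mul.
Qed.

Lemma frac_der_tofrac p : dfrac (tof p) = tof (D p).
Proof.
have D1 : D 1 = 0.
  apply: (@addIr _ (D 1)); rewrite add0r.
  by have := DM 1 1; rewrite !mulr1 mul1r => <-.
have e : tof p = tof p / tof 1 by rewrite tofrac1 divr1.
rewrite {1}e frac_derE ?oner_eq0 // D1 mulr0 subr0 mulr1.
by rewrite tofrac1 expr1n divr1.
Qed.

End FracDer.

(* The algebra K[s] with s ^ 2 = N, whose elements are the a + b s with a
   and b in K, and the extension of D to it, where s' = N' / (2 s), that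
   is (N' / (2 N)) s. *)
Section RadDer.
Variables (K : fieldType) (N : K) (D : K -> K).
Local Notation E := {poly %/ ('X^2 - N%:P)}.

Definition rad_elt (a : K) : E := in_qpoly _ a%:P.
Definition radical : E := in_qpoly _ 'X.

Definition rad_der (x : E) : E :=
  let a := (val x)`_0 in let b := (val x)`_1 in
  rad_elt (D a) + rad_elt (D b + b * (D N / (2 * N))) * radical.

Hypothesis DD : {morph D : x y / x + y}.
Hypothesis DM : forall x y, D (x * y) = D x * y + x * D y.
Hypothesis N_neq0 : N != 0.
Hypothesis two_neq0 : 2 != 0 :> K.

Let sh : size ('X^2 - N%:P : {poly K}) = 3.
Proof. by rewrite size_XnsubC. Qed.

Let mh : mk_monic ('X^2 - N%:P : {poly K}) = 'X^2 - N%:P.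
Proof. by rewrite /mk_monic sh monicXnsubC. Qed.

Lemma radical2 : radical ^+ 2 = rad_elt N.
Proof.
have h0 : in_qpoly ('X^2 - N%:P) ('X^2 - N%:P) = 0.
  by apply: val_inj; rewrite /= mh rmodpp // monicXnsubC.
have e : 'X * 'X = ('X^2 - N%:P) + N%:P by rewrite subrK expr2.
by rewrite (expr2 radical) /radical -in_qpolyM e in_qpolyD h0 add0r.
Qed.

Let small a b :
  val (rad_elt a + rad_elt b * radical) = a%:P + b%:P * 'X.
Proof.
rewrite /rad_elt /radical -in_qpolyM -in_qpolyD.
apply: in_qpoly_small.
rewrite mh sh ltnS (leq_trans (size_polyD _ _)) // geq_max size_polyC.
rewrite (leq_trans (leq_b1 _)) //= mul_polyC.
by rewrite (leq_trans (size_scale_leq _ _)) ?size_polyX.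
Qed.

Lemma radE (x : E) :
  x = rad_elt (val x)`_0 + rad_elt (val x)`_1 * radical.
Proof.
apply: val_inj; rewrite small.
apply/polyP=> -[|[|i]]; rewrite coefD coefC coefCM coefX /=;
  rewrite ?mulr0 ?mulr1 ?addr0 ?add0r //.
by rewrite nth_default // (leq_trans (size_npoly _)) // mh sh.
Qed.

Let radcoef (a b : K) : let x := rad_elt a + rad_elt b * radical in
  (val x)`_0 = a /\ (val x)`_1 = b.
Proof.
move=> x; rewrite /x small !coefD !coefC !coefCM !coefX /=.
by rewrite mulr0 mulr1 addr0 add0r.
Qed.

Lemma rad_eltD : {morph rad_elt : x y / x + y}.
Proof. by move=> x y; rewrite /rad_elt polyCD in_qpolyD. Qed.

Lemma rad_eltM : {morph rad_elt : x y / x * y}.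
Proof. by move=> x y; rewrite /rad_elt polyCM in_qpolyM. Qed.

Lemma rad_derE a b : rad_der (rad_elt a + rad_elt b * radical) =
  rad_elt (D a) + rad_elt (D b + b * (D N / (2 * N))) * radical.
Proof. by rewrite /rad_der; have [-> ->] := radcoef a b. Qed.

Lemma rad_derD : {morph rad_der : x y / x + y}.
Proof.
move=> x y; rewrite [x]radE [y]radE.
move: (_`_0) (_`_1) (_`_0) (_`_1) => a b a' b'.
rewrite addrACA -mulrDl -!rad_eltD !rad_derE !DD mulrDl !rad_eltD; ring.
Qed.

Lemma rad_derM x y : rad_der (x * y) = rad_der x * y + x * rad_der y.
Proof.
rewrite [x]radE [y]radE.
move: (_`_0) (_`_1) (_`_0) (_`_1) => a b a' b'.
have mulE p q p' q' :
    (rad_elt p + rad_elt q * radical) * (rad_elt p' + rad_elt q' * radical) =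
    rad_elt (p * p' + q * q' * N) + rad_elt (p * q' + q * p') * radical.
  rewrite !rad_eltD !rad_eltM -radical2; ring.
rewrite mulE !rad_derE !mulE addrACA -mulrDl -!rad_eltD !DD !DM.
congr (rad_elt _ + rad_elt _ * _).
  by field; apply/andP.
by field; apply/andP.
Qed.

End RadDer.

Section Functions.
Context {R : realType}.

Definition Ci : R[i] := Complex 0 1.

(* The coordinates are z11, z22, t, in this order; as z12 = i t, the ring
   C[z11, z12, z22] = C[z11, z22, t] is {mpoly R[i][3]}. *)
Definition k11 : 'I_3 := @Ordinal 3 0 isT.
Definition k22 : 'I_3 := @Ordinal 3 1 isT.
Definition kt : 'I_3 := @Ordinal 3 2 isT.

Definition Zpoly : 'M[{mpoly R[i][3]}]_2 :=
  mx2 'X_k11 (Ci *: 'X_kt) (Ci *: 'X_kt) 'X_k22.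

Definition Npoly : {mpoly R[i][3]} := \det Zpoly.

Lemma NpolyE : Npoly = 'X_k11 * 'X_k22 + 'X_kt ^+ 2.
Proof.
rewrite /Npoly (expand_det_row _ 0) big_ord_recl big_ord1 /cofactor !det_mx11.
rewrite !mxE /= expr0 !mul1r expr1 mulN1r mulrN -scalerAl -scalerAr scalerA.
have -> : Ci * Ci = -1 by rewrite -expr2 sqr_i.
by rewrite scaleN1r opprK expr2.
Qed.

Definition ratfun : fieldType := {fraction {mpoly R[i][3]}}.

Definition tofun (p : {mpoly R[i][3]}) : ratfun := FracField.tofrac p.

Definition NF : ratfun := tofun Npoly.

(* P, as a subset of the field of rational functions. *)
Definition in_P (x : ratfun) : Prop :=
  exists (p : {mpoly R[i][3]}) (n : nat), x = tofun p / NF ^+ n.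

Definition efun : comNzRingType := {poly %/ ('X^2 - NF%:P)}.

Definition rat_e (a : ratfun) : efun := rad_elt NF a.
Definition sqrtN : efun := radical NF.

Definition pder (k : 'I_3) (x : efun) : efun :=
  rad_der (frac_der (mderiv k)) x.

(* The subspaces P and N(Z)^{1/2} P. *)
Definition integral_P (x : efun) : Prop :=
  exists a : ratfun, in_P a /\ x = rat_e a.
Definition half_P (x : efun) : Prop :=
  exists b : ratfun, in_P b /\ x = sqrtN * rat_e b.

Definition cst (c : R[i]) : efun := rat_e (tofun c%:MP).
Definition cstmx (A : 'M[R[i]]_2) : 'M[efun]_2 := map_mx cst A.
Definition Zm : 'M[efun]_2 := map_mx (fun p => rat_e (tofun p)) Zpoly.

Definition del (x : efun) : 'M[efun]_2 :=
  mx2 (pder k11 x) (cst (- (Ci / 2)) * pder kt x)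
      (cst (- (Ci / 2)) * pder kt x) (pder k22 x).
Definition delplus (x : efun) : 'M[efun]_2 :=
  mx2 (pder k22 x) (cst (Ci / 2) * pder kt x)
      (cst (Ci / 2) * pder kt x) (pder k11 x).

(* The column delplus f, respectively the row g delplus, where delplus acts
   on the entries of f and g. *)
Definition delplus_l (f : 'cV[efun]_2) : 'cV[efun]_2 :=
  \col_i \sum_j delplus (f j 0) i j.
Definition delplus_r (g : 'rV[efun]_2) : 'rV[efun]_2 :=
  \row_j \sum_i delplus (g 0 i) i j.

(* The scalar operator Tr(L del + H), with del acting on x only, and its
   entrywise action on matrices. *)
Definition trop (L H : 'M[efun]_2) (x : efun) : efun :=
  \tr (L *m del x) + \tr H * x.
Definition tropm m n (L H : 'M[efun]_2) (F : 'M[efun]_(m, n)) :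
  'M[efun]_(m, n) := map_mx (trop L H) F.

Definition in_sp4 (X : 'M[R[i]]_(2 + 2)) : Prop :=
  [/\ (ursubmx X)^T = ursubmx X, (dlsubmx X)^T = dlsubmx X
    & drsubmx X = - (ulsubmx X)^T].

Definition LA (A : 'M[efun]_2) : 'M[efun]_2 := A *m Zm + Zm *m A^T.
Definition LC (C : 'M[efun]_2) : 'M[efun]_2 := Zm *m C *m Zm.

Definition act_B m n (B : 'M[efun]_2) (F : 'M[efun]_(m, n)) :
  'M[efun]_(m, n) := - tropm B 0 F.

Definition in_M (x : efun) : Prop := half_P x.
Definition rhoM_A (A : 'M[efun]_2) (x : efun) : efun :=
  - trop (LA A) (3 *: A) x.
Definition rhoM_B (B : 'M[efun]_2) (x : efun) : efun := - trop B 0 x.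
Definition rhoM_C (C : 'M[efun]_2) (x : efun) : efun :=
  trop (LC C) (3 *: (C *m Zm)) x.
Definition rhoM (X : 'M[R[i]]_(2 + 2)) (x : efun) : efun :=
  rhoM_A (cstmx (ulsubmx X)) x + rhoM_B (cstmx (ursubmx X)) x
  + rhoM_C (cstmx (dlsubmx X)) x.

Definition in_W (F : 'M[efun]_2) : Prop :=
  F^T = F /\ forall i j, half_P (F i j).
Definition rho2_A (A F : 'M[efun]_2) : 'M[efun]_2 :=
  - tropm (LA A) (2 *: A) F + A *m F + F *m A^T.
Definition rho2_C (C F : 'M[efun]_2) : 'M[efun]_2 :=
  tropm (LC C) (2 *: (Zm *m C)) F - Zm *m C *m F - F *m C *m Zm.
Definition rho2 (X : 'M[R[i]]_(2 + 2)) (F : 'M[efun]_2) : 'M[efun]_2 :=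
  rho2_A (cstmx (ulsubmx X)) F + act_B (cstmx (ursubmx X)) F
  + rho2_C (cstmx (dlsubmx X)) F.

Definition in_Vplus (f : 'cV[efun]_2) : Prop :=
  (forall i, integral_P (f i 0)) /\ delplus_l f = 0.
Definition in_Vminus (f : 'cV[efun]_2) : Prop :=
  (forall i, half_P (f i 0)) /\ delplus_l f = 0.
Definition pil_A (A : 'M[efun]_2) (f : 'cV[efun]_2) : 'cV[efun]_2 :=
  - tropm (LA A) (cst (1 / 2) *: A) f - A^T *m f.
Definition pil_C (C : 'M[efun]_2) (f : 'cV[efun]_2) : 'cV[efun]_2 :=
  tropm (LC C) (cst (1 / 2) *: (C *m Zm)) f + C *m Zm *m f.
Definition pil (X : 'M[R[i]]_(2 + 2)) (f : 'cV[efun]_2) : 'cV[efun]_2 :=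
  pil_A (cstmx (ulsubmx X)) f + act_B (cstmx (ursubmx X)) f
  + pil_C (cstmx (dlsubmx X)) f.

Definition in_Vplus' (g : 'rV[efun]_2) : Prop :=
  (forall i, integral_P (g 0 i)) /\ delplus_r g = 0.
Definition in_Vminus' (g : 'rV[efun]_2) : Prop :=
  (forall i, half_P (g 0 i)) /\ delplus_r g = 0.
Definition pir_A (A : 'M[efun]_2) (g : 'rV[efun]_2) : 'rV[efun]_2 :=
  - tropm (LA A) (cst (1 / 2) *: A) g - g *m A.
Definition pir_C (C : 'M[efun]_2) (g : 'rV[efun]_2) : 'rV[efun]_2 :=
  tropm (LC C) (cst (1 / 2) *: (Zm *m C)) g + g *m Zm *m C.
Definition pir (X : 'M[R[i]]_(2 + 2)) (g : 'rV[efun]_2) : 'rV[efun]_2 :=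
  pir_A (cstmx (ulsubmx X)) g + act_B (cstmx (ursubmx X)) g
  + pir_C (cstmx (dlsubmx X)) g.

Definition mul3 (g : 'rV[efun]_2) (F : 'M[efun]_2) (f : 'cV[efun]_2) : efun :=
  (g *m F *m f) 0 0.

End Functions.

Arguments ratfun R : clear implicits.
Arguments efun R : clear implicits.

(* Main.v *)
Require Import Defs.
From mathcomp Require Import all_boot all_order all_algebra.
From mathcomp Require Import reals complex.
From mathcomp Require Import mpoly.
From mathcomp Require Import ring.
Import GRing.Theory.
Local Open Scope ring_scope.

(* Each of the three actions is a first-order operator Tr(L del + H) with the
   same vector field L, plus a matrix multiplication term.  The scalar parts
   1/2, 2, 1/2 add up to 3, so by the Leibniz rule the differential operators
   combine into the action on M, while the multiplication terms cancel inside
   the product g F f. *)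

(** * Nonvanishing of N(Z) and of 2 *)

Lemma Npoly_neq0 (R : realType) : @Npoly R != 0.
Proof.
(* At the point z11 = z22 = 1, t = 0 the polynomial N takes the value 1. *)
apply/eqP => /(congr1 (meval (fun i => if i == kt then 0 else 1))).
rewrite NpolyE mevalD mevalM rmorphXn /= !mevalXU meval0 /= expr0n addr0 mulr1.
by move/eqP; rewrite oner_eq0.
Qed.

Lemma NF_neq0 (R : realType) : @NF R != 0.
Proof. by rewrite /NF /tofun tofrac_eq0 Npoly_neq0. Qed.

Lemma ratfun_two_neq0 (R : realType) : 2 != 0 :> ratfun R.
Proof.
rewrite -(rmorph_nat (@FracField.tofrac _)) tofrac_eq0.
by rewrite -(rmorph_nat (@mpolyC _ _)) mpolyC_eq0 Num.Theory.pnatr_eq0.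
Qed.

Lemma mx2D (V : nmodType) (a b c d a' b' c' d' : V) :
  mx2 (a + a') (b + b') (c + c') (d + d') = mx2 a b c d + mx2 a' b' c' d'.
Proof. by apply/matrixP => i j; rewrite !mxE; do 2!case: ifP. Qed.

Lemma mx2Z (E : pzRingType) (k a b c d : E) :
  k *: mx2 a b c d = mx2 (k * a) (k * b) (k * c) (k * d).
Proof. by apply/matrixP => i j; rewrite !mxE; do 2!case: ifP. Qed.

(* Stated over an abstract ring because [ring] and [rewrite] unfold the
   operations of efun R. *)
Section RingIdentities.
Context {E : comNzRingType}.
Implicit Types a b c p q r x y : E.

(** This is the product rule for [del], with p, q, r and p', q', r' standing for the derivatives of
    x and y in z11, t, z22, and c for -i/2. *)
Lemma mx2_leibniz c x y p p' q q' r r' :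
  mx2 (p * y + x * p') (c * (q * y + x * q'))
      (c * (q * y + x * q')) (r * y + x * r') =
  y *: mx2 p (c * q) (c * q) r + x *: mx2 p' (c * q') (c * q') r'.
Proof. by rewrite !mx2Z -mx2D; congr mx2; ring. Qed.

Lemma mulr_radical x a b c : a * (x * b) * c = x * (a * b * c).
Proof. by ring. Qed.

Lemma mulr_radical3 x a b c :
  x * a * (x * b) * (x * c) = x * (x ^+ 2 * (a * b * c)).
Proof. by ring. Qed.

Lemma mxtrace_leibniz n (L U V : 'M[E]_n) x y :
  \tr (L *m (y *: U + x *: V)) = \tr (L *m U) * y + x * \tr (L *m V).
Proof. by rewrite mulmxDr -!scalemxAr mxtraceD !mxtraceZ (mulrC y). Qed.

(** Used to assemble the Leibniz identities of the A, B and C blocks into the one for a full element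
    of sp(4). *)
Lemma mulmx3_add3 m n k l (g1 g2 g3 g : 'M[E]_(m, n)) (F1 F2 F3 F : 'M[E]_(n, k))
    (f1 f2 f3 f : 'M[E]_(k, l)) i j :
  ((g1 *m F *m f) i j + (g *m F1 *m f) i j + (g *m F *m f1) i j)
  + ((g2 *m F *m f) i j + (g *m F2 *m f) i j + (g *m F *m f2) i j)
  + ((g3 *m F *m f) i j + (g *m F3 *m f) i j + (g *m F *m f3) i j) =
  ((g1 + g2 + g3) *m F *m f) i j + (g *m (F1 + F2 + F3) *m f) i j
  + (g *m F *m (f1 + f2 + f3)) i j.
Proof.
rewrite !(mulmxDl, mulmxDr).
by rewrite ![fun_of_matrix (_ + _) _ _]mxE; ring.
Qed.

End RingIdentities.

(** Models Tr(L del + H), with D = Tr(L del) and h = Tr H: only the trace of H matters. *)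
Definition first_order {E : comNzRingType} (D : E -> E) (h x : E) : E :=
  D x + h * x.

(** * Leibniz rules for first-order operators on matrix products *)

Section FirstOrder.
Context {E : comNzRingType} (D : E -> E).
Context (DD : {morph D : x y / x + y})
  (DM : forall x y, D (x * y) = D x * y + x * D y).
Local Notation T h := (map_mx (first_order D h)).

Lemma first_orderD h : {morph first_order D h : x y / x + y}.
Proof. by move=> x y; rewrite /first_order DD mulrDr addrACA. Qed.

Lemma first_order0 h : first_order D h 0 = 0.
Proof. by apply: (addIr (first_order D h 0)); rewrite -first_orderD !add0r. Qed.

(** The zeroth-order coefficient can be split freely between the two factors, since h and k both
    just multiply x y. *)
Lemma first_orderM h k x y :
  first_order D (h + k) (x * y) = first_order D h x * y + x * first_order D k y.
Proof. by rewrite /first_order DM; ring. Qed.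

Lemma first_order_mulmx h k m n p (F : 'M[E]_(m, n)) (G : 'M[E]_(n, p)) :
  T (h + k) (F *m G) = T h F *m G + F *m T k G.
Proof.
apply/matrixP => i j; rewrite !mxE (big_morph _ (first_orderD _) (first_order0 _)).
by rewrite -big_split; apply: eq_bigr => l _; rewrite first_orderM !mxE.
Qed.

Section Triple.
Context (m n p q : nat).
Context (g : 'M[E]_(m, n)) (F : 'M[E]_(n, p)) (f : 'M[E]_(p, q)).
Context (i : 'I_m) (j : 'I_q) (h h1 h2 h3 : E) (hE : h = h1 + h2 + h3).

(** The terms g P F f and g F Q f each occur once with either sign: P sits between g and F, Q
    between F and f. *)
Lemma first_order_twist (P : 'M[E]_n) (Q : 'M[E]_p) :
  first_order D h ((g *m F *m f) i j) =
  ((T h1 g + g *m P) *m F *m f) i j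
  + (g *m (T h2 F - P *m F - F *m Q) *m f) i j
  + (g *m F *m (T h3 f + Q *m f)) i j.
Proof.
have -> : first_order D h ((g *m F *m f) i j) =
    (T (h1 + h2 + h3) (g *m F *m f)) i j by rewrite hE [RHS]mxE.
rewrite !first_order_mulmx !(mulmxDl, mulmxDr, mulmxN, mulNmx) !mulmxA.
rewrite ![fun_of_matrix (_ + _) _ _]mxE ![fun_of_matrix (- _) _ _]mxE; ring.
Qed.

(** The sign convention of the A and B actions. *)
Lemma first_order_twistN (P : 'M[E]_n) (Q : 'M[E]_p) :
  - first_order D h ((g *m F *m f) i j) =
  ((- T h1 g - g *m P) *m F *m f) i j
  + (g *m (- T h2 F + P *m F + F *m Q) *m f) i j
  + (g *m F *m (- T h3 f - Q *m f)) i j.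
Proof.
rewrite (first_order_twist P Q) !(mulmxDl, mulmxDr, mulmxN, mulNmx).
rewrite ![fun_of_matrix (_ + _) _ _]mxE ![fun_of_matrix (- _) _ _]mxE; ring.
Qed.

End Triple.
End FirstOrder.

(** * Derivations on the function algebra, and equivariance block by block *)

Section Derivations.
Context {R : realType}.
Implicit Types (x y : efun R) (L H : 'M[efun R]_2).

Lemma pderD k : {morph @pder R k : x y / x + y}.
Proof. exact/rad_derD/(frac_derD (mderivD k) (mderivM k)). Qed.

Lemma pderM k x y : pder k (x * y) = pder k x * y + x * pder k y.
Proof.
(* The derivative of the square root of N is (N' / (2 N)) times that root, so 2 and N must be
   invertible. *)
apply: rad_derM; [| | exact: NF_neq0 | exact: ratfun_two_neq0].
  exact: (frac_derD (mderivD k) (mderivM k)).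
exact: (frac_derM (mderivM k)).
Qed.

Lemma delD x y : del (x + y) = del x + del y.
Proof. by rewrite /del !pderD mulrDr mx2D. Qed.

Lemma delM x y : del (x * y) = y *: del x + x *: del y.
Proof. by rewrite /del !pderM mx2_leibniz. Qed.

Definition der_along L x : efun R := \tr (L *m del x).

Lemma der_alongD L : {morph der_along L : x y / x + y}.
Proof. by move=> x y; rewrite /der_along delD mulmxDr mxtraceD. Qed.

Lemma der_alongM L x y :
  der_along L (x * y) = der_along L x * y + x * der_along L y.
Proof. by rewrite /der_along delM; apply: mxtrace_leibniz. Qed.

Lemma cst_half2 : cst (1 / 2) + cst (1 / 2) = 1 :> efun R.
Proof.
rewrite /cst /rat_e /tofun -rad_eltD -tofracD -mpolyCD.
by rewrite -Num.Theory.splitr mpolyC1 tofrac1 /rad_elt polyC1 in_qpoly1.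
Qed.

(** Two matrices are allowed because the C action uses both C Z and Z C, which have the same
    trace. *)
Lemma mxtrace_half_two_half (H H' : 'M[efun R]_2) : \tr H = \tr H' ->
  \tr (3 *: H) = \tr (cst (1 / 2) *: H') + \tr (2 *: H') + \tr (cst (1 / 2) *: H).
Proof.
move=> HH'; rewrite !mxtraceZ -HH' -!mulrDl addrAC cst_half2.
by congr (_ * _); rewrite -natr1 addrC.
Qed.

Section Mul3.
Variables (g : 'rV[efun R]_2) (F : 'M[efun R]_2) (f : 'cV[efun R]_2).

Lemma mul3_A A : rhoM_A A (mul3 g F f) =
  mul3 (pir_A A g) F f + mul3 g (rho2_A A F) f + mul3 g F (pil_A A f).
Proof.
(* The twists are P = A and Q = A^T. *)
exact (first_order_twistN _ (der_alongD (LA A)) (der_alongM (LA A)) _ _ _ _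
  g F f 0 0 _ _ _ _ (mxtrace_half_two_half A A erefl) A A^T).
Qed.

Lemma mul3_B B : rhoM_B B (mul3 g F f) =
  mul3 (act_B B g) F f + mul3 g (act_B B F) f + mul3 g F (act_B B f).
Proof.
have tr0 : \tr (0 : 'M[efun R]_2) =
    \tr (0 : 'M[efun R]_2) + \tr (0 : 'M[efun R]_2) + \tr (0 : 'M[efun R]_2).
  by rewrite mxtrace0 !addr0.
have := first_order_twistN _ (der_alongD B) (der_alongM B) _ _ _ _ g F f 0 0
  _ _ _ _ tr0 0 0.
by rewrite !(mulmx0, mul0mx, subr0, addr0).
Qed.

Lemma mul3_C C : rhoM_C C (mul3 g F f) =
  mul3 (pir_C C g) F f + mul3 g (rho2_C C F) f + mul3 g F (pil_C C f).
Proof.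
(* Reassociation exposes the twists P = Z C and Q = C Z. *)
rewrite /pir_C /rho2_C -(mulmxA g) -(mulmxA F).
exact (first_order_twist _ (der_alongD (LC C)) (der_alongM (LC C)) _ _ _ _
  g F f 0 0 _ _ _ _ (mxtrace_half_two_half _ _ (mxtrace_mulC C Zm))
  (Zm *m C) (C *m Zm)).
Qed.

Lemma mul3_equivariant (X : 'M[R[i]]_(2 + 2)) : rhoM X (mul3 g F f) =
  mul3 (pir X g) F f + mul3 g (rho2 X F) f + mul3 g F (pil X f).
Proof. by rewrite /rhoM mul3_A mul3_B mul3_C; apply: mulmx3_add3. Qed.

End Mul3.
End Derivations.

(** * The product g F f lies in M *)

Section Membership.
Context {R : realType}.
Implicit Types (a b : ratfun R) (x y z : efun R).

Lemma NF_in_P : in_P (@NF R).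
Proof. by exists Npoly, 0%N; rewrite divr1. Qed.

Lemma in_PD a b : in_P a -> in_P b -> in_P (a + b).
Proof.
move=> [p [n ->]] [q [m ->]].
exists (p * Npoly ^+ m + q * Npoly ^+ n), (n + m)%N.
rewrite addf_div ?expf_neq0 ?NF_neq0 // exprD.
by rewrite /tofun tofracD !tofracM !tofracXn.
Qed.

Lemma in_PM a b : in_P a -> in_P b -> in_P (a * b).
Proof.
move=> [p [n ->]] [q [m ->]]; exists (p * q), (n + m)%N.
by rewrite mulf_div exprD /tofun tofracM.
Qed.

Lemma half_P0 : half_P (0 : efun R).
Proof.
exists 0; split; first by exists 0, 0%N; rewrite /tofun tofrac0 mul0r.
by rewrite /rat_e /rad_elt polyC0 in_qpoly0 mulr0.
Qed.

Lemma half_PD x y : half_P x -> half_P y -> half_P (x + y).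
Proof.
move=> [a [Pa ->]] [b [Pb ->]]; exists (a + b); split; first exact: in_PD.
by rewrite /rat_e rad_eltD mulrDr.
Qed.

Lemma half_P_mul_integral x y z :
  integral_P x -> half_P y -> integral_P z -> half_P (x * y * z).
Proof.
move=> [a [Pa ->]] [b [Pb ->]] [c [Pc ->]].
exists (a * b * c); split; first by apply: in_PM => //; apply: in_PM.
by rewrite /rat_e !rad_eltM mulr_radical.
Qed.

Lemma half_P_mul_half x y z :
  half_P x -> half_P y -> half_P z -> half_P (x * y * z).
Proof.
move=> [a [Pa ->]] [b [Pb ->]] [c [Pc ->]].
(* The cube of the square root of N is N times that root, and the factor N is absorbed into P. *)
exists (NF * (a * b * c)); split.
  by apply: (in_PM _ _ NF_in_P); apply: in_PM => //; apply: in_PM.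
by rewrite /rat_e !rad_eltM -radical2 mulr_radical3.
Qed.

Lemma half_P_mul3 (g : 'rV[efun R]_2) (F : 'M[efun R]_2) (f : 'cV[efun R]_2) :
  (forall i j, half_P (g 0 i * F i j * f j 0)) -> half_P (mul3 g F f).
Proof.
move=> gFf; rewrite /mul3 mxE.
apply: (big_ind _ half_P0 half_PD) => j _; rewrite mxE mulr_suml.
by apply: (big_ind _ half_P0 half_PD) => i _.
Qed.

End Membership.

Theorem proposition112 (R : realType) :
  (forall (g : 'rV[efun R]_2) (F : 'M[efun R]_2) (f : 'cV[efun R]_2),
      in_Vplus' g -> in_W F -> in_Vplus f ->
      in_M (mul3 g F f) /\
      forall X : 'M[R[i]]_(2 + 2), in_sp4 X ->
        rhoM X (mul3 g F f) =
          mul3 (pir X g) F f + mul3 g (rho2 X F) f + mul3 g F (pil X f))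
  /\
  (forall (g : 'rV[efun R]_2) (F : 'M[efun R]_2) (f : 'cV[efun R]_2),
      in_Vminus' g -> in_W F -> in_Vminus f ->
      in_M (mul3 g F f) /\
      forall X : 'M[R[i]]_(2 + 2), in_sp4 X ->
        rhoM X (mul3 g F f) =
          mul3 (pir X g) F f + mul3 g (rho2 X F) f + mul3 g F (pil X f)).
Proof.
split=> g F f [gP _] [_ FP] [fP _]; split=> [|X _].
- by apply: half_P_mul3 => i j; apply: half_P_mul_integral.
- exact: mul3_equivariant.
- by apply: half_P_mul3 => i j; apply: half_P_mul_half.
- exact: mul3_equivariant.
Qed.
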